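(* For every $n\ge 0$, elements of the free mirig $R_n$ are presented by elements of $\mathbb{N}_{2,2}[M_n]$, i.e. the quotient map $S_n \to R_n$ factors through a surjection $\mathbb{N}_{2,2}[M_n]\to R_n$. In particular, $|R_n| \leq |\mathbb{N}_{2,2}[M_n]| = 4^{|M_n|}$ is finite for all $n$.
   Context: A rig is a semiring with $0$ and $1$ (addition commutative, multiplication not assumed commutative, $0$ absorbing for multiplication). A mirig is a rig in which $x^2=x$ for all $x$. $S_n$ is the free (noncommutative) rig on an $n$-element set $[n]$, and $R_n = S_n/{\approx}$ is the free mirig on $[n]$, where $\approx$ is the congruence on $S_n$ generated by $r \approx r^2$ for all $r \in S_n$. $M_n$ is the free idempotent monoid on $[n]$: the quotient of the free monoid $F_n$ on $[n]$ by the congruence generated by $w\sim ww$ for all words $w$ (it is a known theorem of Green and Rees that $M_n$ is finite). $\mathbb{N}_{2,2}$ is the rig with underlying set $\{0,1,2,3\}$, with addition and multiplication as in $\mathbb{N}$ except that any result greater than $3$ is reduced modulo $2$ into $\{2,3\}$ (the quotient of $\mathbb{N}$ by the congruence generated by $2=4$). $\mathbb{N}_{2,2}[M_n]$ is the monoid rig of formal sums of elements of $M_n$ with coefficients in $\mathbb{N}_{2,2}$; it is the quotient of $S_n$ by the rig congruence generated by $w\sim ww$ for words $w$ together with $2\simeq 4$. *)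

(* Defs.v *)
From HB Require Import structures.
From mathcomp Require Import all_boot all_order all_algebra finmap.
From mathcomp Require Import zify.
From mathcomp Require Import boolp classical_sets functions cardinality.

Set Implicit Arguments.
Unset Strict Implicit.
Unset Printing Implicit Defensive.

Import GRing.Theory.

Local Open Scope ring_scope.
Local Open Scope quotient_scope.

(* A rig is a [pzSemiRingType]: addition is commutative, multiplication need
   not be, 0 is absorbing, and 0 = 1 is not excluded.  A monoid is a
   [monoidType], written multiplicatively in [group_scope]. *)

Inductive monoid_cong (M : monoidType) (g : M -> M -> Prop) : M -> M -> Prop :=
| MonoidCongGen x y : g x y -> monoid_cong g x y
| MonoidCongRefl x : monoid_cong g x x
| MonoidCongSym x y : monoid_cong g x y -> monoid_cong g y x
| MonoidCongTrans y x z :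
    monoid_cong g x y -> monoid_cong g y z -> monoid_cong g x z
| MonoidCongMul x x' y y' :
    monoid_cong g x x' -> monoid_cong g y y' ->
    monoid_cong g (x * y)%g (x' * y')%g.

Section MonoidQuotient.
Variables (M : monoidType) (g : M -> M -> Prop).

Definition monoid_congb : rel M := fun x y => `[< monoid_cong g x y >].

Lemma monoid_congb_refl : reflexive monoid_congb.
Proof. by move=> x; apply/asboolP; apply: MonoidCongRefl. Qed.

Lemma monoid_congb_sym : symmetric monoid_congb.
Proof.
by move=> x y; apply/asboolP/asboolP => h; apply: MonoidCongSym.
Qed.

Lemma monoid_congb_trans : transitive monoid_congb.
Proof.
move=> y x z /asboolP xy /asboolP yz.
by apply/asboolP; apply: MonoidCongTrans xy yz.
Qed.

Canonical monoid_cong_equiv :=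
  EquivRel monoid_congb monoid_congb_refl monoid_congb_sym monoid_congb_trans.

Definition monoid_quot := {eq_quot monoid_cong_equiv}.

HB.instance Definition _ := EqQuotient.on monoid_quot.
HB.instance Definition _ := Choice.on monoid_quot.

Lemma monoid_quotP (x y : M) :
  reflect (monoid_cong g x y) (\pi_monoid_quot x == \pi_monoid_quot y).
Proof. by rewrite eqquotE; apply: asboolP. Qed.

Lemma monoid_quot_eq (x y : M) :
  \pi_monoid_quot x = \pi_monoid_quot y <-> monoid_cong g x y.
Proof. by split => [/eqP/monoid_quotP//|h]; apply/eqP/monoid_quotP. Qed.

Definition monoid_quot_one : monoid_quot := \pi_monoid_quot 1%g.
Definition monoid_quot_mul (x y : monoid_quot) : monoid_quot :=
  \pi_monoid_quot (repr x * repr y)%g.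

Lemma monoid_quot_mulE (x y : M) :
  monoid_quot_mul (\pi x) (\pi y) = \pi_monoid_quot (x * y)%g.
Proof.
by apply/monoid_quot_eq; apply: MonoidCongMul; apply/monoid_quot_eq;
   rewrite reprK.
Qed.

Lemma monoid_quot_mulA : associative monoid_quot_mul.
Proof.
elim/quotW => x; elim/quotW => y; elim/quotW => z.
by rewrite !monoid_quot_mulE mulgA.
Qed.

Lemma monoid_quot_mul1 : left_id monoid_quot_one monoid_quot_mul.
Proof. by elim/quotW => x; rewrite monoid_quot_mulE mul1g. Qed.

Lemma monoid_quot_1mul : right_id monoid_quot_one monoid_quot_mul.
Proof. by elim/quotW => x; rewrite monoid_quot_mulE mulg1. Qed.

HB.instance Definition _ := isMonoid.Build monoid_quot
  monoid_quot_mulA monoid_quot_mul1 monoid_quot_1mul.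

Lemma monoid_quotM (x y : M) :
  \pi_monoid_quot (x * y)%g = (\pi_monoid_quot x * \pi_monoid_quot y)%g.
Proof. by rewrite -monoid_quot_mulE. Qed.

Lemma monoid_quot1 : \pi_monoid_quot 1%g = 1%g.
Proof. by []. Qed.

End MonoidQuotient.

Inductive rig_cong (S : pzSemiRingType) (g : S -> S -> Prop) : S -> S -> Prop :=
| RigCongGen x y : g x y -> rig_cong g x y
| RigCongRefl x : rig_cong g x x
| RigCongSym x y : rig_cong g x y -> rig_cong g y x
| RigCongTrans y x z : rig_cong g x y -> rig_cong g y z -> rig_cong g x z
| RigCongAdd x x' y y' :
    rig_cong g x x' -> rig_cong g y y' -> rig_cong g (x + y) (x' + y')
| RigCongMul x x' y y' :
    rig_cong g x x' -> rig_cong g y y' -> rig_cong g (x * y) (x' * y').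

Section RigQuotient.
Variables (S : pzSemiRingType) (g : S -> S -> Prop).

Definition rig_congb : rel S := fun x y => `[< rig_cong g x y >].

Lemma rig_congb_refl : reflexive rig_congb.
Proof. by move=> x; apply/asboolP; apply: RigCongRefl. Qed.

Lemma rig_congb_sym : symmetric rig_congb.
Proof. by move=> x y; apply/asboolP/asboolP => h; apply: RigCongSym. Qed.

Lemma rig_congb_trans : transitive rig_congb.
Proof.
move=> y x z /asboolP xy /asboolP yz.
by apply/asboolP; apply: RigCongTrans xy yz.
Qed.

Canonical rig_cong_equiv :=
  EquivRel rig_congb rig_congb_refl rig_congb_sym rig_congb_trans.

Definition rig_quot := {eq_quot rig_cong_equiv}.

HB.instance Definition _ := EqQuotient.on rig_quot.
HB.instance Definition _ := Choice.on rig_quot.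

Lemma rig_quotP (x y : S) :
  reflect (rig_cong g x y) (\pi_rig_quot x == \pi_rig_quot y).
Proof. by rewrite eqquotE; apply: asboolP. Qed.

Lemma rig_quot_eq (x y : S) :
  \pi_rig_quot x = \pi_rig_quot y <-> rig_cong g x y.
Proof. by split => [/eqP/rig_quotP//|h]; apply/eqP/rig_quotP. Qed.

Definition rig_quot_zero : rig_quot := \pi_rig_quot 0.
Definition rig_quot_one : rig_quot := \pi_rig_quot 1.
Definition rig_quot_add (x y : rig_quot) : rig_quot := \pi_rig_quot (repr x + repr y).
Definition rig_quot_mul (x y : rig_quot) : rig_quot := \pi_rig_quot (repr x * repr y).

Lemma rig_quot_addE (x y : S) : rig_quot_add (\pi x) (\pi y) = \pi_rig_quot (x + y).
Proof.
by apply/rig_quot_eq; apply: RigCongAdd; apply/rig_quot_eq; rewrite reprK.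
Qed.

Lemma rig_quot_mulE (x y : S) : rig_quot_mul (\pi x) (\pi y) = \pi_rig_quot (x * y).
Proof.
by apply/rig_quot_eq; apply: RigCongMul; apply/rig_quot_eq; rewrite reprK.
Qed.

Let piE := (rig_quot_addE, rig_quot_mulE).

Lemma rig_quot_addA : associative rig_quot_add.
Proof.
by elim/quotW => x; elim/quotW => y; elim/quotW => z; rewrite !piE addrA.
Qed.
Lemma rig_quot_addC : commutative rig_quot_add.
Proof. by elim/quotW => x; elim/quotW => y; rewrite !piE addrC. Qed.
Lemma rig_quot_add0 : left_id rig_quot_zero rig_quot_add.
Proof. by elim/quotW => x; rewrite !piE add0r. Qed.
Lemma rig_quot_mulA : associative rig_quot_mul.
Proof.
by elim/quotW => x; elim/quotW => y; elim/quotW => z; rewrite !piE mulrA.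
Qed.
Lemma rig_quot_mul1l : left_id rig_quot_one rig_quot_mul.
Proof. by elim/quotW => x; rewrite !piE mul1r. Qed.
Lemma rig_quot_mul1r : right_id rig_quot_one rig_quot_mul.
Proof. by elim/quotW => x; rewrite !piE mulr1. Qed.
Lemma rig_quot_mulDl : left_distributive rig_quot_mul rig_quot_add.
Proof.
by elim/quotW => x; elim/quotW => y; elim/quotW => z; rewrite !piE mulrDl.
Qed.
Lemma rig_quot_mulDr : right_distributive rig_quot_mul rig_quot_add.
Proof.
by elim/quotW => x; elim/quotW => y; elim/quotW => z; rewrite !piE mulrDr.
Qed.
Lemma rig_quot_mul0l : left_zero rig_quot_zero rig_quot_mul.
Proof. by elim/quotW => x; rewrite !piE mul0r. Qed.
Lemma rig_quot_mul0r : right_zero rig_quot_zero rig_quot_mul.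
Proof. by elim/quotW => x; rewrite !piE mulr0. Qed.

HB.instance Definition _ := GRing.isPzSemiRing.Build rig_quot
  rig_quot_addA rig_quot_addC rig_quot_add0 rig_quot_mulA rig_quot_mul1l
  rig_quot_mul1r rig_quot_mulDl rig_quot_mulDr rig_quot_mul0l rig_quot_mul0r.

Definition rig_proj (x : S) : rig_quot := \pi_rig_quot x.

Fact rig_proj_nmod_morphism : nmod_morphism rig_proj.
Proof. by split=> // x y; rewrite /rig_proj -rig_quot_addE. Qed.
Fact rig_proj_monoid_morphism : monoid_morphism rig_proj.
Proof. by split=> // x y; rewrite /rig_proj -rig_quot_mulE. Qed.

HB.instance Definition _ :=
  GRing.isNmodMorphism.Build S rig_quot rig_proj rig_proj_nmod_morphism.
HB.instance Definition _ :=
  GRing.isMonoidMorphism.Build S rig_quot rig_proj rig_proj_monoid_morphism.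

Lemma rig_projP (x y : S) : rig_proj x = rig_proj y <-> rig_cong g x y.
Proof. exact: rig_quot_eq. Qed.

Lemma rig_proj_surj (q : rig_quot) : exists x, rig_proj x = q.
Proof. by exists (repr q); rewrite /rig_proj reprK. Qed.

End RigQuotient.

(* Elements are the finite formal sums of elements of M with coefficients
   in R; multiplication ([mr_mul] below) is convolution. *)
Definition monoid_rig (R : pzSemiRingType) (M : monoidType) :=
  {fsfun M -> R with 0}.

HB.instance Definition _ (R : pzSemiRingType) (M : monoidType) :=
  Choice.on (monoid_rig R M).

Section MonoidRig.
Variables (R : pzSemiRingType) (M : monoidType).
Local Notation RM := (monoid_rig R M).
Local Open Scope fset_scope.
Local Open Scope ring_scope.
Implicit Types (f : RM) (c : R) (x y : M) (d : {fset M}).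

Definition mr_coef f x : R := (f : {fsfun M -> R with 0}) x.
Definition mr_supp f : {fset M} := finsupp (f : {fsfun M -> R with 0}).

Definition mr_single c x : RM := [fsfun y in [fset x] => c | 0].

Definition mr_zero : RM := [fsfun for fun=> 0].
Definition mr_add f1 f2 : RM :=
  [fsfun x in mr_supp f1 `|` mr_supp f2 => mr_coef f1 x + mr_coef f2 x | 0].

Lemma mr_ext f1 f2 : mr_coef f1 =1 mr_coef f2 -> f1 = f2.
Proof. by move=> h; apply/fsfunP. Qed.

Lemma mr_coef_out f x : x \notin mr_supp f -> mr_coef f x = 0.
Proof. exact: fsfun_dflt. Qed.

Lemma mr_coef_zero x : mr_coef mr_zero x = 0.
Proof. by rewrite /mr_coef fsfunE. Qed.

Lemma mr_coef_add f1 f2 x :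
  mr_coef (mr_add f1 f2) x = mr_coef f1 x + mr_coef f2 x.
Proof.
rewrite {1}/mr_coef fsfunE; case: ifPn => //.
by rewrite in_fsetU negb_or => /andP[/mr_coef_out-> /mr_coef_out->]; rewrite addr0.
Qed.

Lemma mr_addA : associative mr_add.
Proof. by move=> a b c; apply: mr_ext => x; rewrite !mr_coef_add addrA. Qed.
Lemma mr_addC : commutative mr_add.
Proof. by move=> a b; apply: mr_ext => x; rewrite !mr_coef_add addrC. Qed.
Lemma mr_add0 : left_id mr_zero mr_add.
Proof.
by move=> a; apply: mr_ext => x; rewrite mr_coef_add mr_coef_zero add0r.
Qed.

HB.instance Definition _ :=
  GRing.isNmodule.Build RM mr_addA mr_addC mr_add0.

Lemma mr_coefD f1 f2 x : mr_coef (f1 + f2) x = mr_coef f1 x + mr_coef f2 x.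
Proof. exact: mr_coef_add. Qed.

Lemma mr_coef0 x : mr_coef 0 x = 0.
Proof. exact: mr_coef_zero. Qed.

Lemma mr_coef_single c x y : mr_coef (mr_single c x) y = if y == x then c else 0.
Proof. by rewrite /mr_coef fsfunE in_fset1. Qed.

Lemma mr_single0 x : mr_single 0 x = 0.
Proof.
by apply: mr_ext => y; rewrite mr_coef_single mr_coef0; case: ifP.
Qed.

Lemma mr_singleD c c' x : mr_single (c + c') x = mr_single c x + mr_single c' x.
Proof.
apply: mr_ext => y; rewrite mr_coefD !mr_coef_single.
by case: ifP => // _; rewrite addr0.
Qed.

Lemma mr_coef_sum (I : Type) (r : seq I) (F : I -> RM) x :
  mr_coef (\sum_(i <- r) F i) x = \sum_(i <- r) mr_coef (F i) x.
Proof.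
apply: (big_morph (mr_coef^~ x)); first by move=> a b; apply: mr_coefD.
exact: mr_coef0.
Qed.

Lemma mr_supp_single c x : mr_supp (mr_single c x) `<=` [fset x].
Proof. exact: finsupp_sub. Qed.

Lemma mr_supp_add f1 f2 : mr_supp (f1 + f2) `<=` mr_supp f1 `|` mr_supp f2.
Proof. exact: finsupp_sub. Qed.

Lemma mr_supp0 : mr_supp 0 = fset0.
Proof. exact: finsupp0. Qed.

Lemma mr_sum_supp (T : nmodType) (F : R -> M -> T) f d :
  (forall x, F 0 x = 0) -> mr_supp f `<=` d ->
  \sum_(x <- mr_supp f) F (mr_coef f x) x = \sum_(x <- d) F (mr_coef f x) x.
Proof.
move=> F0 sd; apply: big_fset_incl => // x _ /mr_coef_out ->; exact: F0.
Qed.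

(* The value at [f] of the additive map sending each c x to F c x. *)
Definition mr_ext_add (T : nmodType) (F : R -> M -> T) f : T :=
  \sum_(x <- mr_supp f) F (mr_coef f x) x.

Section ExtAdd.
Variables (T : nmodType) (F : R -> M -> T).
Hypothesis F0 : forall x, F 0 x = 0.
Hypothesis FD : forall c c' x, F (c + c') x = F c x + F c' x.

Lemma mr_ext_add0 : mr_ext_add F 0 = 0.
Proof. by rewrite /mr_ext_add mr_supp0 big_seq_fset0. Qed.

Lemma mr_ext_addD f1 f2 :
  mr_ext_add F (f1 + f2) = mr_ext_add F f1 + mr_ext_add F f2.
Proof.
rewrite /mr_ext_add (mr_sum_supp F0 (mr_supp_add f1 f2)).
rewrite (mr_sum_supp F0 (fsubsetUl (mr_supp f1) (mr_supp f2))).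
rewrite (mr_sum_supp F0 (fsubsetUr (mr_supp f1) (mr_supp f2))).
by rewrite -big_split; apply: eq_bigr => x _; rewrite mr_coefD FD.
Qed.

Lemma mr_ext_add_single c x : mr_ext_add F (mr_single c x) = F c x.
Proof.
rewrite /mr_ext_add (mr_sum_supp F0 (mr_supp_single c x)) big_seq_fset1.
by rewrite mr_coef_single eqxx.
Qed.

End ExtAdd.

Lemma mr_sumE f : f = \sum_(x <- mr_supp f) mr_single (mr_coef f x) x.
Proof.
apply: mr_ext => y; rewrite mr_coef_sum.
under eq_bigr do rewrite mr_coef_single.
have [yf|/[dup] yf /mr_coef_out ->] := boolP (y \in mr_supp f).
  rewrite (big_fsetD1 y) //= eqxx big1_fset ?addr0 // => x.
  by rewrite in_fsetD1 eq_sym => /andP[/negPf ->].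
rewrite big1_fset // => x xf _; case: eqP => // yx.
by rewrite yx xf in yf.
Qed.

Lemma mr_ind (P : RM -> Prop) :
  P 0 -> (forall f1 f2, P f1 -> P f2 -> P (f1 + f2)) ->
  (forall c x, P (mr_single c x)) -> forall f, P f.
Proof.
by move=> P0 PD P1 f; rewrite (mr_sumE f); apply: big_ind.
Qed.

Definition mr_one : RM := mr_single 1 1%g.
Definition mr_mul f1 f2 : RM :=
  \sum_(x <- mr_supp f1) \sum_(y <- mr_supp f2)
    mr_single (mr_coef f1 x * mr_coef f2 y) (x * y)%g.

Lemma mr_mulE f1 f2 :
  mr_mul f1 f2 =
  mr_ext_add (fun c x => mr_ext_add (fun c' y => mr_single (c * c') (x * y)%g) f2) f1.
Proof. by []. Qed.

Lemma mr_mul_mulC f1 f2 :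
  mr_mul f1 f2 =
  mr_ext_add (fun c' y => mr_ext_add (fun c x => mr_single (c * c') (x * y)%g) f1) f2.
Proof. exact: exchange_big. Qed.

Lemma mr_mulDl : left_distributive mr_mul +%R.
Proof.
move=> a b c; rewrite !mr_mulE mr_ext_addD // => [x|c1 c2 x].
  by rewrite /mr_ext_add big1 // => y _; rewrite mul0r mr_single0.
by rewrite -big_split; apply: eq_bigr => y _; rewrite mulrDl mr_singleD.
Qed.

Lemma mr_mulDr : right_distributive mr_mul +%R.
Proof.
move=> a b c; rewrite !mr_mul_mulC mr_ext_addD // => [x|c1 c2 x].
  by rewrite /mr_ext_add big1 // => y _; rewrite mulr0 mr_single0.
by rewrite -big_split; apply: eq_bigr => y _; rewrite mulrDr mr_singleD.
Qed.

Lemma mr_mul0l : left_zero 0 mr_mul.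
Proof. by move=> a; rewrite mr_mulE mr_ext_add0. Qed.

Lemma mr_mul0r : right_zero 0 mr_mul.
Proof. by move=> a; rewrite mr_mul_mulC mr_ext_add0. Qed.

Lemma mr_mul_single c x c' x' :
  mr_mul (mr_single c x) (mr_single c' x') = mr_single (c * c') (x * x')%g.
Proof.
have F0 (e : R) (y z : M) : mr_single (e * 0) (y * z)%g = 0 by rewrite mulr0 mr_single0.
rewrite mr_mulE mr_ext_add_single ?mr_ext_add_single // => y.
by rewrite /mr_ext_add big1 // => z _; rewrite mul0r mr_single0.
Qed.

Lemma mr_mul1l : left_id mr_one mr_mul.
Proof.
elim/mr_ind => [|a b iha ihb|c x].
- exact: mr_mul0r.
- by rewrite mr_mulDr iha ihb.
- by rewrite mr_mul_single mul1r mul1g.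
Qed.

Lemma mr_mul1r : right_id mr_one mr_mul.
Proof.
elim/mr_ind => [|a b iha ihb|c x].
- exact: mr_mul0l.
- by rewrite mr_mulDl iha ihb.
- by rewrite mr_mul_single mulr1 mulg1.
Qed.

Lemma mr_mulA : associative mr_mul.
Proof.
move=> a b c; elim/mr_ind: a => [|a a' iha iha'|p x].
- by rewrite !mr_mul0l.
- by rewrite !mr_mulDl iha iha'.
elim/mr_ind: b => [|b b' ihb ihb'|q y].
- by rewrite !(mr_mul0l, mr_mul0r).
- by rewrite !(mr_mulDl, mr_mulDr) ihb ihb'.
elim/mr_ind: c => [|c c' ihc ihc'|r z].
- by rewrite !mr_mul0r.
- by rewrite !mr_mulDr ihc ihc'.
by rewrite !mr_mul_single mulrA mulgA.
Qed.

HB.instance Definition _ := GRing.Nmodule_isPzSemiRing.Build RM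
  mr_mulA mr_mul1l mr_mul1r mr_mulDl mr_mulDr mr_mul0l mr_mul0r.

Lemma mr_singleM c x c' x' :
  mr_single (c * c') (x * x')%g = mr_single c x * mr_single c' x'.
Proof. by rewrite -mr_mul_single. Qed.

End MonoidRig.

Section MonoidRigLift.
Variables (R T : pzSemiRingType) (M : monoidType).
Variables (a : {rmorphism R -> T}) (b : M -> T).
Hypothesis b1 : b 1%g = 1.
Hypothesis bM : forall x y, b (x * y)%g = b x * b y.
Hypothesis abC : forall c x, a c * b x = b x * a c.

Definition mr_lift (f : monoid_rig R M) : T :=
  mr_ext_add (fun c x => a c * b x) f.

Let F0 x : a 0 * b x = 0. Proof. by rewrite rmorph0 mul0r. Qed.
Let FD c c' x : a (c + c') * b x = a c * b x + a c' * b x.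
Proof. by rewrite rmorphD mulrDl. Qed.

Lemma mr_lift_single c x : mr_lift (mr_single c x) = a c * b x.
Proof. exact: (@mr_ext_add_single _ _ _ (fun c x => a c * b x)). Qed.

Fact mr_lift_nmod_morphism : nmod_morphism mr_lift.
Proof.
split; first exact: mr_ext_add0.
by move=> f g; apply: (@mr_ext_addD _ _ _ (fun c x => a c * b x)).
Qed.

Fact mr_lift_monoid_morphism : monoid_morphism mr_lift.
Proof.
have [L0 LD] := mr_lift_nmod_morphism.
split=> [|f g]; first by rewrite mr_lift_single b1 rmorph1 mulr1.
elim/mr_ind: f => [|f f' ihf ihf'|c x]; first by rewrite !(mul0r, L0).
  by rewrite mulrDl !LD ihf ihf' mulrDl.
elim/mr_ind: g => [|g g' ihg ihg'|d y]; first by rewrite !(mulr0, L0).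
  by rewrite mulrDr !LD ihg ihg' mulrDr.
rewrite -mr_singleM !mr_lift_single rmorphM bM.
by rewrite -!mulrA (mulrA (b x)) -abC -!mulrA.
Qed.

End MonoidRigLift.

Section MonoidRigMap.
Variables (R R' : pzSemiRingType) (M M' : monoidType).
Variables (a : R -> R') (b : M -> M').

Definition mr_map (f : monoid_rig R M) : monoid_rig R' M' :=
  \sum_(x <- mr_supp f) mr_single (a (mr_coef f x)) (b x).

End MonoidRigMap.

Section MonoidRigMapMorphism.
Variables (R R' : pzSemiRingType) (M M' : monoidType).
Variables (a : {rmorphism R -> R'}) (b : M -> M').
Hypothesis b1 : b 1%g = 1%g.
Hypothesis bM : forall x y, b (x * y)%g = (b x * b y)%g.

Let F0 x : mr_single (a 0) (b x) = 0. Proof. by rewrite rmorph0 mr_single0. Qed.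
Let FD c c' x :
  mr_single (a (c + c')) (b x) = mr_single (a c) (b x) + mr_single (a c') (b x).
Proof. by rewrite rmorphD mr_singleD. Qed.

Lemma mr_map_single c x : mr_map a b (mr_single c x) = mr_single (a c) (b x).
Proof. exact: (@mr_ext_add_single _ _ _ (fun c x => mr_single (a c) (b x))). Qed.

Fact mr_map_nmod_morphism : nmod_morphism (mr_map a b).
Proof.
split; first exact: (mr_ext_add0 (fun c x => mr_single (a c) (b x))).
by move=> f g; apply: (@mr_ext_addD _ _ _ (fun c x => mr_single (a c) (b x))).
Qed.

Fact mr_map_monoid_morphism : monoid_morphism (mr_map a b).
Proof.
have [L0 LD] := mr_map_nmod_morphism.
split=> [|f g]; first by rewrite mr_map_single b1 rmorph1.
elim/mr_ind: f => [|f f' ihf ihf'|c x]; first by rewrite !(mul0r, L0).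
  by rewrite mulrDl !LD ihf ihf' mulrDl.
elim/mr_ind: g => [|g g' ihg ihg'|d y]; first by rewrite !(mulr0, L0).
  by rewrite mulrDr !LD ihg ihg' mulrDr.
by rewrite -mr_singleM !mr_map_single rmorphM bM mr_singleM.
Qed.

End MonoidRigMapMorphism.

(* Results > 3 are reduced modulo 2 into {2, 3}. *)
Definition red22 (k : nat) : nat := if (k <= 3)%N then k else (2 + k %% 2)%N.

Lemma red22_lt k : (red22 k < 4)%N.
Proof.
rewrite /red22; case: (leqP k 3) => // _.
by have := ltn_pmod k (isT : 0 < 2)%N; rewrite -(ltn_add2l 2).
Qed.

Lemma red22P k :
  ((k <= 3)%N /\ red22 k = k) \/ ((3 < k)%N /\ red22 k = (2 + k %% 2)%N).
Proof. by rewrite /red22; case: (leqP k 3) => h; [left|right]. Qed.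

Lemma red22_ge2 k l :
  (2 <= k)%N -> (2 <= l)%N -> (k %% 2 = l %% 2)%N -> red22 k = red22 l.
Proof. by have := red22P k; have := red22P l; lia. Qed.

Lemma red22_mod k : (red22 k %% 2 = k %% 2)%N.
Proof. by have := red22P k; lia. Qed.

Lemma red22_small k : (k < 2)%N -> red22 k = k.
Proof. by have := red22P k; lia. Qed.

Lemma red22_large k : (2 <= k)%N -> (2 <= red22 k)%N.
Proof. by have := red22P k; lia. Qed.

Lemma red22_id k : red22 (red22 k) = red22 k.
Proof. by have := red22P k; have := red22P (red22 k); lia. Qed.

Lemma red22D a b : red22 (a + b) = red22 (red22 a + red22 b).
Proof.
have := red22P a; have := red22P b; have := red22P (a + b).
by have := red22P (red22 a + red22 b); lia.
Qed.

Lemma red22M a b : red22 (a * b) = red22 (red22 a * red22 b).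
Proof.
have mod_ab : (a * b %% 2 = red22 a * red22 b %% 2)%N.
  by rewrite -modnMm -(red22_mod a) -(red22_mod b) modnMm.
have [a0|a_gt0] := posnP a; first by rewrite a0.
have [b0|b_gt0] := posnP b; first by rewrite b0 !muln0.
have [a1|a_ne1] := eqVneq a 1%N; first by rewrite a1 !mul1n red22_id.
have [b1|b_ne1] := eqVneq b 1%N; first by rewrite b1 !muln1 red22_id.
have a2 : (2 <= a)%N by lia.
have b2 : (2 <= b)%N by lia.
have := red22_large a2; have := red22_large b2 => rb ra.
by apply: red22_ge2 => //; nia.
Qed.

(* Wrapped, because 'I_4 itself carries the ring structure of Z/4Z. *)
Record N22 := ToN22 { of_N22 : 'I_4 }.

HB.instance Definition _ := [isNew for of_N22].
HB.instance Definition _ := [Finite of N22 by <:].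

Definition N22_nat (a : N22) : nat := of_N22 a.
Definition N22_of_nat (k : nat) : N22 := ToN22 (Ordinal (red22_lt k)).
Definition N22_add (a b : N22) : N22 := N22_of_nat (N22_nat a + N22_nat b)%N.
Definition N22_mul (a b : N22) : N22 := N22_of_nat (N22_nat a * N22_nat b)%N.

Lemma N22_eqP (a b : N22) : N22_nat a = N22_nat b -> a = b.
Proof. by move=> h; do 2![apply: val_inj]. Qed.

Ltac N22_cases :=
  repeat (let a := fresh in
          move=> a; case: a; case; do 4?[case=> //]; move=> ?);
  exact: N22_eqP.

Lemma N22_addA : associative N22_add. Proof. N22_cases. Qed.
Lemma N22_addC : commutative N22_add. Proof. N22_cases. Qed.
Lemma N22_add0 : left_id (N22_of_nat 0) N22_add. Proof. N22_cases. Qed.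
Lemma N22_mulA : associative N22_mul. Proof. N22_cases. Qed.
Lemma N22_mulC : commutative N22_mul. Proof. N22_cases. Qed.
Lemma N22_mul1 : left_id (N22_of_nat 1) N22_mul. Proof. N22_cases. Qed.
Lemma N22_mulDl : left_distributive N22_mul N22_add. Proof. N22_cases. Qed.
Lemma N22_mul0 : left_zero (N22_of_nat 0) N22_mul. Proof. N22_cases. Qed.

HB.instance Definition _ :=
  GRing.isNmodule.Build N22 N22_addA N22_addC N22_add0.
HB.instance Definition _ := GRing.Nmodule_isComPzSemiRing.Build N22
  N22_mulA N22_mulC N22_mul1 N22_mulDl N22_mul0.

Fact N22_of_nat_nmod_morphism : nmod_morphism N22_of_nat.
Proof. by split=> // a b; apply: N22_eqP; exact: (red22D a b). Qed.
Fact N22_of_nat_monoid_morphism : monoid_morphism N22_of_nat.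
Proof. by split=> // a b; apply: N22_eqP; exact: (red22M a b). Qed.

HB.instance Definition _ :=
  GRing.isNmodMorphism.Build nat N22 N22_of_nat N22_of_nat_nmod_morphism.
HB.instance Definition _ :=
  GRing.isMonoidMorphism.Build nat N22 N22_of_nat N22_of_nat_monoid_morphism.

Definition free_monoid (n : nat) := seq 'I_n.

HB.instance Definition _ n := Choice.on (free_monoid n).
HB.instance Definition _ n := isMonoid.Build (free_monoid n)
  (@catA 'I_n) (@cat0s 'I_n) (@cats0 'I_n).

Definition free_idem_monoid (n : nat) : monoidType :=
  monoid_quot (fun u v : free_monoid n => v = (u * u)%g).

(* S_n, as formal sums of words with coefficients in nat; its universal
   property is [free_rig_univ]. *)
Definition free_rig (n : nat) : pzSemiRingType := monoid_rig nat (free_monoid n).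

Definition free_rig_gen n (i : 'I_n) : free_rig n :=
  mr_single 1%N ([:: i] : free_monoid n).

Lemma free_rig_univ n (T : pzSemiRingType) (h : 'I_n -> T) :
  exists f : {rmorphism free_rig n -> T},
    (forall i, f (free_rig_gen i) = h i) /\
    (forall g : {rmorphism free_rig n -> T},
       (forall i, g (free_rig_gen i) = h i) -> g =1 f).
Proof.
pose a : {rmorphism nat -> T} := GRing.natmul 1.
pose b (w : free_monoid n) : T := \prod_(i <- (w : seq 'I_n)) h i.
have b1 : b 1%g = 1 by apply: big_nil.
have bM x y : b (x * y)%g = b x * b y by apply: big_cat.
have abC c x : a c * b x = b x * a c by apply/esym; apply: commr_nat.
pose fN := GRing.isNmodMorphism.Build _ _ _ (mr_lift_nmod_morphism a b).
pose fM := GRing.isMonoidMorphism.Build _ _ _ (mr_lift_monoid_morphism b1 bM abC).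
pose f : {rmorphism free_rig n -> T} :=
  HB.pack_for {rmorphism free_rig n -> T} (mr_lift a b) fN fM.
have fE c x : f (mr_single c x) = a c * b x by apply: mr_lift_single.
exists f; split=> [i|g gE s].
  by rewrite fE /b big_seq1 (rmorph1 a) mul1r.
have gw (w : free_monoid n) : g (mr_single 1%N w) = b w.
  elim: w => [|i w ihw]; first by rewrite b1; apply: rmorph1.
  rewrite /b big_cons -[in RHS]gE -[X in _ * X]ihw -rmorphM.
  by congr (g _); rewrite -[RHS]mr_singleM.
have gS c (w : free_monoid n) : g (mr_single c w) = c%:R * b w.
  elim: c => [|c ihc]; first by rewrite mr_single0 rmorph0 mul0r.
  by rewrite -addn1 mr_singleD rmorphD ihc gw natrD mulrDl mul1r.
elim/mr_ind: s => [|s s' ihs ihs'|c w]; first by rewrite !rmorph0.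
  by rewrite !rmorphD ihs ihs'.
by rewrite gS fE.
Qed.

Definition free_mirig (n : nat) : pzSemiRingType :=
  rig_quot (fun r s : free_rig n => s = r ^+ 2).

Definition to_free_mirig n : {rmorphism free_rig n -> free_mirig n} :=
  rig_proj (fun r s : free_rig n => s = r ^+ 2).

Definition N22_idem (n : nat) : pzSemiRingType :=
  monoid_rig N22 (free_idem_monoid n).

(* The quotient map S_n -> N_{2,2}[M_n]: reduce each coefficient to N_{2,2}
   and each word to M_n, and collect. *)
Definition to_N22_idem n : free_rig n -> N22_idem n :=
  mr_map N22_of_nat (fun w : free_monoid n => \pi_(free_idem_monoid n) w).

HB.instance Definition _ n := GRing.isNmodMorphism.Build _ _ (@to_N22_idem n)
  (mr_map_nmod_morphism _ _).
HB.instance Definition _ n := GRing.isMonoidMorphism.Build _ _ (@to_N22_idem n)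
  (mr_map_monoid_morphism _ (monoid_quot1 _) (@monoid_quotM _ _)).

Lemma free_mirig_idem n (r : free_mirig n) : r ^+ 2 = r.
Proof.
have [s <-] := rig_proj_surj r.
by apply/esym; rewrite -rmorphXn; apply/rig_projP; apply: RigCongGen.
Qed.

(* Main.v *)
From HB Require Import structures.
Require Import Defs.
From mathcomp Require Import all_boot all_order all_algebra finmap.
From mathcomp Require Import zify.
From mathcomp Require Import boolp classical_sets functions cardinality.

(** There are two independent points.

    Factorization.  In a mirig, 2 = 2 ^ 2 = 4, so the unique rig morphism from
    the naturals factors through [N22] ([N22_lift]); and since every element is
    idempotent, the multiplicative map sending a word to its image identifies
    [w] with [w w], so it factors through [free_idem_monoid].  The images of
    naturals are central, hence the two maps together extend to the monoid rig
    ([N22_idem_lift]).  Applied to the projection onto the free mirig, which is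
    surjective, this gives the presentation; the bound on cardinalities
    follows, and 4 ^ |M_n| is the number of functions from M_n to the
    four-element rig ([card_monoid_rig]).

    Finiteness of the free idempotent monoid (Green and Rees).  In an
    idempotent monoid generated by letters, call content of a word its set of
    letters.  The crucial fact is that [u x u = u] as soon as the content of
    [x] is included in that of [u] ([sandwich_content]).  It follows that a word
    is the product of any prefix and any suffix that both have full content
    ([eval_prefix_suffix]): whatever lies between them is absorbed.  Choose the
    shortest such prefix and the shortest such suffix: removing its last letter
    from the prefix, and its first letter from the suffix, leaves words with
    one letter less in their content.  So every value of a word on k + 1
    letters is determined by two values of words on k letters and two letters,
    and induction on the number of letters of the content bounds the number of
    values ([finite_eval_content]). *)

Import GRing.Theory.

Local Open Scope classical_set_scope.
Local Open Scope card_scope.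

(** * Cutting a word where its content is complete

    The content of a word is its set of letters, and [size (undup s)] counts
    the distinct letters of [s]. *)

Section Words.
Variable T : eqType.
Implicit Types (p q r s : seq T).

(** The cut at which every letter of [s] has occurred: [rcons p i] is the
    shortest prefix with the content of [s], so [p] misses exactly the
    letter [i]. *)
Lemma first_completion s : s != [::] ->
  exists p i r, [/\ s = rcons p i ++ r, i \notin p & rcons p i =i s].
Proof.
elim/last_ind: s => // s i IHs _.
have [i_s|is_] := boolP (i \in s); last first.
  by exists s, i, [::]; split; rewrite ?cats0.
have /IHs[p [j [r [sE jp pE]]]] : s != [::] by case: (s) i_s.
exists p, j, (rcons r i); split=> //; first by rewrite sE rcons_cat.
by move=> k; rewrite pE mem_rcons inE; case: eqP => // ->.
Qed.

Lemma last_completion s : s != [::] ->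
  exists q i r, [/\ s = r ++ i :: q, i \notin q & i :: q =i s].
Proof.
rewrite -size_eq0 -size_rev size_eq0 => /first_completion[p [i [r [sE ip pE]]]].
exists (rev p), i, (rev r); split; last 1 first.
- by move=> k; rewrite -[RHS]mem_rev -pE mem_rcons !inE mem_rev.
- by rewrite -[s]revK sE rev_cat rev_rcons.
- by rewrite mem_rev.
Qed.

(** This is what makes the induction on the size of the content decrease. *)
Lemma size_undup_missing p s i :
  i \notin p -> {subset i :: p <= s} -> (size (undup p) < size (undup s))%N.
Proof.
move=> ip sub; rewrite -/(size (i :: undup p)).
apply: uniq_leq_size => [|j]; first by rewrite /= mem_undup ip undup_uniq.
by rewrite inE !mem_undup => jp; apply: sub; rewrite inE.
Qed.

End Words.

(** * Finitely generated idempotent monoids are finite *)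

Section IdempotentMonoid.
Variable M : monoidType.
Hypothesis mulMM : forall x : M, (x * x = x)%g.
Local Open Scope group_scope.
Implicit Types u v w x y : M.

(** Let [e = u x u].  The element [e u] is [e], because [e] ends with the
    idempotent [u]; it is also [u], because [e (x w) = u] exhibits [u] as a
    right multiple of the idempotent [e]. *)
Lemma sandwich_divisor_r u x w : u * x * w = u -> u * x * u = u.
Proof.
move=> uxw; pose e := u * x * u.
have exw : e * (x * w) = u by rewrite /e mulgA -(mulgA (u * x) u x) mulMM uxw.
have eu_u : e * u = u by rewrite -[in LHS]exw mulgA mulMM exw.
by rewrite -[RHS]eu_u /e -[RHS]mulgA mulMM.
Qed.

(** With [u = v x w], idempotency of [x w] gives [u x w = u]. *)
Lemma sandwich_factor v x w : (v * x * w) * x * (v * x * w) = v * x * w.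
Proof.
apply: (@sandwich_divisor_r _ _ w).
transitivity (v * ((x * w) * (x * w))); first by rewrite !mulgA.
by rewrite mulMM mulgA.
Qed.

(** The product [u y u x u = u] meets [y] before [x]; squaring its middle part
    gives [u y u x y u x u], where the factor [x y] appears between two
    sandwiches [u y u] and [u x u] that collapse to [u]. *)
Lemma sandwichM u x y : u * x * u = u -> u * y * u = u -> u * (x * y) * u = u.
Proof.
move=> uxu uyu; have uyxu : u * (y * u * x) * u = u.
  by rewrite !mulgA uyu uxu.
rewrite -[RHS]uyxu -(mulMM (y * u * x)) !mulgA uyu.
by rewrite -!mulgA (mulgA u x u) uxu.
Qed.

(** Write the right-hand [v] as [v u v] and collapse the sandwich around
    [x v]. *)
Lemma sandwich_collapse u v x :
  u * (x * v) * u = u -> v * u * v = v -> u * x * v = u * v.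
Proof. by move=> uxvu vuv; rewrite -{1}vuv -[in RHS]uxvu !mulgA. Qed.

Section Generators.
Variables (T : finType) (h : T -> M).
Implicit Types (p q r s : seq T).

Local Notation eval s := (\big[*%g/1%g]_(i <- s) h i).

(** The set of [x] with [u x u = u] is a submonoid ([sandwichM]) that contains
    every letter of [u] ([sandwich_factor]). *)
Lemma sandwich_content s r : {subset r <= s} -> eval s * eval r * eval s = eval s.
Proof.
elim: r => [|i r IHr] sub; first by rewrite big_nil mulg1 mulMM.
rewrite big_cons; apply: sandwichM; last first.
  by apply: IHr => j jr; apply: sub; rewrite inE jr orbT.
have /path.splitPr[s1 s2] : i \in s by apply: sub; rewrite inE eqxx.
by rewrite big_cat big_cons /= (mulgA (eval s1)) sandwich_factor.
Qed.

(** Squaring the word and reading it once in each way gives [p r s q], whose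
    middle part [r s] has all its letters in [p] and in [q]. *)
Lemma eval_prefix_suffix p r q s :
  p ++ r = s ++ q -> p =i p ++ r -> q =i s ++ q ->
  eval (p ++ r) = eval p * eval q.
Proof.
move=> E pE qE; have pq : p =i q by move=> i; rewrite pE qE E.
rewrite -(mulMM (eval (p ++ r))) {2}E !big_cat /= !mulgA.
rewrite -(mulgA (eval p)); apply: sandwich_collapse.
  have := @sandwich_content p ((r ++ s) ++ q); rewrite !big_cat /=; apply => i.
  rewrite !mem_cat; case/orP => [/orP[ir|is_]|iq].
  - by rewrite pE mem_cat ir orbT.
  - by rewrite pq qE mem_cat is_.
  - by rewrite pq.
by apply: sandwich_content => i; rewrite pq.
Qed.

Lemma finite_eval_content k :
  finite_set [set eval s | s in [set s | (size (undup s) <= k)%N]].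
Proof.
elim: k => [|k IHk].
  apply: sub_finite_set (finite_set1 1) => _ [s /= + <-].
  by rewrite leqn0 size_eq0 => /eqP/undup_nil ->; rewrite big_nil.
set X := (X in finite_set X) in IHk.
pose XT := [set x * h i | x in X & i in [set: T]].
pose TX := [set h i * x | i in [set: T] & x in X].
have finT := @finite_finset T setT.
have finXT : finite_set XT by apply: finite_image2.
have finTX : finite_set TX by apply: finite_image2.
have fin : finite_set ([set 1] `|` [set x * y | x in XT & y in TX]).
  by rewrite finite_setU; split; [exact: finite_set1 | exact: finite_image2].
apply: sub_finite_set fin => _ [s /= sk <-].
have [->|s_neq0] := eqVneq s [::]; [left|right].
  by rewrite /= big_nil.
have [p [i [r [sp ip pE]]]] := first_completion _ _ s_neq0.
have [q [j [t [sq jq qE]]]] := last_completion _ _ s_neq0.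
have inX (w : seq T) l : l \notin w -> {subset l :: w <= s} -> X (eval w).
  move=> lw sub; exists w => //=; rewrite -ltnS.
  exact: leq_trans (size_undup_missing _ _ _ _ lw sub) sk.
exists (eval (rcons p i)).
  exists (eval p); last by exists i => //; rewrite big_rcons.
  by apply: inX ip _ => l; rewrite -pE mem_rcons.
exists (eval (j :: q)).
  exists j => //; exists (eval q); last by rewrite big_cons.
  by apply: inX jq _ => l; rewrite -qE.
by rewrite sp; apply/esym/(@eval_prefix_suffix _ _ _ t); rewrite -?sp -?sq.
Qed.

Lemma finite_eval : finite_set [set eval s | s in [set: seq T]].
Proof.
apply: sub_finite_set (finite_eval_content #|T|) => _ [s _ <-].
by exists s => //=; rewrite cardE; apply: uniq_leq_size => [|i _];
  rewrite ?undup_uniq ?mem_enum.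
Qed.

End Generators.
End IdempotentMonoid.

(** * Counting formal sums *)

Section MonoidRigCard.
Variables (R : finPzSemiRingType) (M : monoidType).
Local Open Scope ring_scope.

Lemma card_monoid_rig : finite_set [set: M] ->
  [set: monoid_rig R M] #= `I_(#|R| ^ #|` fset_set [set: M]|)%N.
Proof.
move=> finM; set D := fset_set _.
have inD x : x \in D by rewrite in_fset_set ?in_setT.
pose g (f : monoid_rig R M) := [ffun x : D => mr_coef f (val x)].
have g_inj : {in [set: monoid_rig R M] &, injective g}.
  move=> f f' _ _ /ffunP gff'; apply: mr_ext => x.
  by have := gff' [` inD x]%fset; rewrite !ffunE.
have g_surj : g @` setT = [set: {ffun D -> R}].
  apply/seteqP; split=> // phi _.
  exists (\sum_(x : D) mr_single (phi x) (val x)) => //.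
  apply/ffunP => y; rewrite ffunE mr_coef_sum (bigD1 y) //= mr_coef_single eqxx.
  rewrite big1 ?addr0 // => x xy; rewrite mr_coef_single.
  by rewrite (inj_eq val_inj) eq_sym (negPf xy).
apply: card_eq_trans (card_esym (inj_card_eq g_inj)) _; rewrite g_surj.
have rank_inj : {in [set: {ffun D -> R}] &, injective enum_rank}.
  by move=> x y _ _; apply: enum_rank_inj.
apply: card_eq_trans (card_esym (inj_card_eq rank_inj)) _.
have -> : enum_rank @` [set: {ffun D -> R}] = setT.
  by apply/seteqP; split=> // k _; exists (enum_val k) => //; apply: enum_valK.
by rewrite card_ffun -cardfE card_eq_sym; apply: card_II.
Qed.

End MonoidRigCard.

(** * The free idempotent monoid and the factorization *)

Lemma finite_free_idem_monoid n : finite_set [set: free_idem_monoid n].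
Proof.
pose h (i : 'I_n) : free_idem_monoid n :=
  (\pi_(free_idem_monoid n) ([:: i] : free_monoid n))%qT.
apply: sub_finite_set (finite_eval _ _ _ h) => [|]; last first.
  elim/quotW => w; rewrite -monoid_quotM.
  by apply/monoid_quot_eq/MonoidCongSym/MonoidCongGen.
elim/quotW => w _; exists w => //; elim: w => [|i w IHw]; rewrite ?big_nil //.
by rewrite big_cons IHw -monoid_quotM.
Qed.

Section Factorization.
Local Open Scope ring_scope.
Local Open Scope quotient_scope.

Lemma N22_natK : cancel N22_nat N22_of_nat.
Proof.
case=> [[k k_lt4]]; apply: N22_eqP.
by rewrite /N22_nat /= /red22 -ltnS k_lt4.
Qed.

Lemma card_N22 : #|{: N22}| = 4.
Proof.
by rewrite (@bij_eq_card _ _ of_N22) ?card_ord //; exists ToN22 => // -[].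
Qed.

(** The relation 2 = 4 makes the images of naturals above 1 periodic of
    period 2, which is exactly the reduction [red22]. *)
Lemma N22_lift (T : pzSemiRingType) : 2%:R = 4%:R :> T ->
  exists a : {rmorphism N22 -> T}, forall k, a (N22_of_nat k) = k%:R.
Proof.
move=> T24; pose a (c : N22) : T := (N22_nat c)%:R.
have per r m : (2 + r + m * 2)%:R = (2 + r)%:R :> T.
  elim: m => [|m IHm]; first by rewrite addn0.
  rewrite -[RHS]IHm (_ : 2 + r + m.+1 * 2 = r + m * 2 + 4)%N; last by lia.
  by rewrite (_ : 2 + r + m * 2 = r + m * 2 + 2)%N ?natrD ?T24 //; lia.
have aE k : a (N22_of_nat k) = k%:R.
  rewrite /a /N22_nat /= /red22; case: leqP => // k_gt3.
  (* [red22 k] is 2 plus the parity of [k], which is that of [k - 2]. *)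
  rewrite -(per _ (k.-2 %/ 2)%N); congr _%:R.
  by have := divn_eq k.-2 2; have : k = k.-2.+2 by [case: k k_gt3 => [|[|]]]; lia.
have aD : nmod_morphism a.
  split=> // c d; rewrite -[c]N22_natK -[d]N22_natK -rmorphD !aE; exact: natrD.
have aM : monoid_morphism a.
  split=> // c d; rewrite -[c]N22_natK -[d]N22_natK -rmorphM !aE; exact: natrM.
pose aDm := GRing.isNmodMorphism.Build _ _ _ aD.
pose aMm := GRing.isMonoidMorphism.Build _ _ _ aM.
by exists (HB.pack_for {rmorphism N22 -> T} a aDm aMm).
Qed.

Lemma monoid_cong_morph (M : monoidType) (N : Type) (op : N -> N -> N)
    (g : M -> M -> Prop) (h : M -> N) :
  {morph h : x y / (x * y)%g >-> op x y} -> (forall x y, g x y -> h x = h y) ->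
  forall x y, monoid_cong g x y -> h x = h y.
Proof.
move=> hM hg x y; elim=> {x y} [x y /hg //|//|x y _ -> //|y x z _ -> _ -> //|].
by move=> x x' y y' _ xx' _ yy'; rewrite !hM xx' yy'.
Qed.

(** Any morphism to a mirig factors, not only the universal one: all that is
    used about the target is that the relations presenting N_{2,2}[M_n], namely
    [w = w w] and 2 = 4, are instances of [x ^+ 2 = x] there. *)
Lemma N22_idem_lift n (T : pzSemiRingType) (g : {rmorphism free_rig n -> T}) :
  (forall x : T, x ^+ 2 = x) ->
  exists f : {rmorphism N22_idem n -> T}, forall s, f (to_N22_idem s) = g s.
Proof.
move=> TT; have [|a aE] := @N22_lift T; first by rewrite -[LHS]TT -natrX.
pose w1 (w : free_monoid n) : T := g (mr_single 1%N w).
have w1M v w : w1 (v * w)%g = w1 v * w1 w by rewrite /w1 -rmorphM -mr_singleM.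
pose b (x : free_idem_monoid n) : T := w1 (repr x).
have bE w : b (\pi w) = w1 w.
  apply: (@monoid_cong_morph _ _ *%R _ _ w1M); last first.
    by apply/monoid_quot_eq; exact: (reprK (\pi_(free_idem_monoid n) w)).
  by move=> u v ->; rewrite w1M -expr2 TT.
have b1 : b 1%g = 1 by rewrite -monoid_quot1 bE /w1; apply: rmorph1.
have bM x y : b (x * y)%g = b x * b y.
  by elim/quotW: x => x; elim/quotW: y => y; rewrite -monoid_quotM !bE.
have abC c x : a c * b x = b x * a c.
  by rewrite -[c]N22_natK aE; apply/esym/commr_nat.
pose fN := GRing.isNmodMorphism.Build _ _ _ (mr_lift_nmod_morphism a b).
pose fM := GRing.isMonoidMorphism.Build _ _ _ (mr_lift_monoid_morphism b1 bM abC).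
pose f : {rmorphism N22_idem n -> T} :=
  HB.pack_for {rmorphism N22_idem n -> T} (mr_lift a b) fN fM.
exists f; elim/mr_ind=> [|s t IHs IHt|c w]; first by rewrite !rmorph0.
  by rewrite !rmorphD IHs IHt.
have -> : g (mr_single c w) = c%:R * w1 w.
  elim: c => [|c IHc]; first by rewrite mr_single0 rmorph0 mul0r.
  by rewrite -addn1 mr_singleD rmorphD IHc natrD mulrDl mul1r.
rewrite /to_N22_idem mr_map_single -aE -bE; exact: mr_lift_single.
Qed.

End Factorization.

Theorem lemma4p6 (n : nat) :
  (exists f : {rmorphism N22_idem n -> free_mirig n},
     (forall s : free_rig n, f (to_N22_idem s) = to_free_mirig n s) /\
     (forall r : free_mirig n, exists x : N22_idem n, f x = r)) /\
  finite_set [set: free_idem_monoid n] /\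
  ([set: N22_idem n] #= `I_(4 ^ #|` fset_set [set: free_idem_monoid n]|)%N) /\
  ([set: free_mirig n] #<= [set: N22_idem n]) /\
  finite_set [set: free_mirig n].
Proof.
have [f fE] := N22_idem_lift n _ (to_free_mirig n) (@free_mirig_idem n).
have f_surj r : exists x, f x = r.
  have [s <-] := rig_proj_surj r.
  by exists (to_N22_idem s); rewrite fE.
have finM := finite_free_idem_monoid n.
have card_N : [set: N22_idem n] #=
    `I_(4 ^ #|` fset_set [set: free_idem_monoid n]|)%N.
  by have := card_monoid_rig N22 _ finM; rewrite card_N22.
have card_f : [set: free_mirig n] #<= [set: N22_idem n].
  have <- : f @` setT = setT.
    by apply/seteqP; split=> // r _; have [x] := f_surj r; exists x.
  exact: card_image_le.
do !split=> //; first by exists f.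
by apply: card_le_finite card_f _; apply/finite_setP; eexists; apply: card_N.
Qed.
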